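(* Let $p\ge1$ be an integer, let $f:\mathbb{R}^d\to\mathbb{R}$ be convex with $L_p$-Lipschitz $p$-th derivative, let $g$ be a proper closed convex function, and let $\tilde x_k\in\mathbb{R}^d$. Suppose $\tilde y_{k+1}\in\mathbb{R}^d$ is an inexact solution of the tensor subproblem in the sense that $$\left\|\nabla\Big(f_p(\cdot,\tilde x_k)+\frac{L_p}{p!}\|\cdot-\tilde x_k\|^{p+1}+g\Big)(\tilde y_{k+1})\right\|\le\frac{L_p}{2\,p!}\|\tilde y_{k+1}-\tilde x_k\|^p,$$ and that $\lambda_{k+1}>0$ satisfies $$\frac12\le\lambda_{k+1}\frac{L_p\|\tilde y_{k+1}-\tilde x_k\|^{p-1}}{(p-1)!}\le\frac p{p+1}.$$ Then $$\big\|\tilde y_{k+1}-\big(\tilde x_k-\lambda_{k+1}(\nabla f(\tilde y_{k+1})+g'(\tilde y_{k+1}))\big)\big\|\le\frac34\,\|\tilde y_{k+1}-\tilde x_k\|.$$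
   Context: $\|\cdot\|$ is the Euclidean norm. $f_p(y,x)=f(x)+\sum_{k=1}^p\frac1{k!}D^kf(x)[y-x]^k$ is the $p$-th order Taylor expansion of $f$ at $x$. $g'(\tilde y_{k+1})$ denotes $\nabla g(\tilde y_{k+1})$ if $g$ is differentiable, and otherwise a fixed subgradient of $g$ at $\tilde y_{k+1}$, which is then also the one used in place of $\nabla g$ in the gradient in the hypothesis. *)

(* Defs.v *)
From HB Require Import structures.
From mathcomp Require Import all_boot all_order all_algebra.
From mathcomp Require Import all_classical all_reals all_analysis.

Set Implicit Arguments.
Unset Strict Implicit.
Unset Printing Implicit Defensive.

Import Order.TTheory GRing.Theory Num.Theory.
Import numFieldNormedType.Exports.

Local Open Scope classical_set_scope.
Local Open Scope ring_scope.

(* R^d is 'rV[R]_d.  The library norm `|x| on matrices is the sup norm; it is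
   used only through the topology and the differential, which do not depend on
   the choice of a norm.  All quantitative estimates use enorm. *)

Definition dotp (R : realType) (d : nat) (u v : 'rV[R]_d) : R :=
  \sum_(i < d) u ord0 i * v ord0 i.

Definition enorm (R : realType) (d : nat) (u : 'rV[R]_d) : R :=
  Num.sqrt (dotp u u).

Definition grad (R : realType) (d : nat) (f : 'rV[R]_d -> R) (x : 'rV[R]_d) :
    'rV[R]_d :=
  \row_(i < d) ('d f x) (delta_mx ord0 i).

(* Dn f [:: h_1; ...; h_k] x is D^k f(x)[h_1, ..., h_k], the k-th Frechet
   derivative evaluated on k directions: D^k f(x)[h_1, ..., h_k] is the
   derivative at x, along h_1, of z |-> D^(k-1) f(z)[h_2, ..., h_k]. *)
Fixpoint Dn (R : realType) (d : nat) (f : 'rV[R]_d -> R)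
    (hs : seq 'rV[R]_d) (x : 'rV[R]_d) : R :=
  if hs is h :: hs' then ('d (Dn f hs') x) h else f x.

(* In finite dimension a map z |-> D^k f(z) into the k-linear forms is Frechet
   differentiable iff all its evaluations z |-> D^k f(z)[h_1, ..., h_k] are. *)
Definition differentiable_upto (R : realType) (d p : nat) (f : 'rV[R]_d -> R) :=
  forall hs : seq 'rV[R]_d, (size hs < p)%N ->
  forall x : 'rV[R]_d, differentiable (Dn f hs) x.

(* Operator norm of a p-linear form with respect to the Euclidean norm. *)
Definition opnorm (R : realType) (d p : nat) (T : p.-tuple 'rV[R]_d -> R) :
    \bar R :=
  ereal_sup [set (`|T h|)%:E | h in
    [set h : p.-tuple 'rV[R]_d | forall i : 'I_p, enorm (tnth h i) <= 1]].

Definition lipschitz_derivative (R : realType) (d p : nat) (L : R)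
    (f : 'rV[R]_d -> R) :=
  differentiable_upto p f /\
  forall x y : 'rV[R]_d,
    (opnorm (fun h : p.-tuple 'rV[R]_d => Dn f h x - Dn f h y)%R
       <= (L * enorm (x - y))%R%:E)%E.

(* f_p(y, x), the Taylor expansion at x evaluated at y. *)
Definition taylor (R : realType) (d p : nat) (f : 'rV[R]_d -> R)
    (y x : 'rV[R]_d) : R :=
  f x + \sum_(1 <= k < p.+1) (k`!%:R)^-1 * Dn f (nseq k (y - x)) x.

Definition epigraph (R : realType) (d : nat) (g : 'rV[R]_d -> \bar R) :
    set ('rV[R]_d * R^o) :=
  [set z | (g z.1 <= (z.2 : R)%:E)%E].

Definition proper_closed_convex (R : realType) (d : nat)
    (g : 'rV[R]_d -> \bar R) :=
  [/\ (forall x, g x != -oo%E) /\ (exists x, g x != +oo%E),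
      closed (epigraph g) &
      convex_set (epigraph g)].

Definition subgradient (R : realType) (d : nat) (g : 'rV[R]_d -> \bar R)
    (y v : 'rV[R]_d) :=
  forall z : 'rV[R]_d, (g y + (dotp v (z - y))%R%:E <= g z)%E.

Definition ediff (R : realType) (d : nat) (g : 'rV[R]_d -> \bar R)
    (y : 'rV[R]_d) :=
  (\forall z \near y, g z \is a fin_num) /\
  differentiable (fun z => fine (g z)) y.

(* v is a legitimate value of g'(y). *)
Definition is_gprime (R : realType) (d : nat) (g : 'rV[R]_d -> \bar R)
    (y v : 'rV[R]_d) :=
  (ediff g y -> v = grad (fun z => fine (g z)) y) /\
  (~ ediff g y -> subgradient g y v).

(* The gradient of h + g at y, for h differentiable at y; if g is not
   differentiable at y, the chosen subgradient v = g'(y) replaces the gradient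
   of g. *)
Definition composite_grad (R : realType) (d : nat) (h : 'rV[R]_d -> R)
    (g : 'rV[R]_d -> \bar R) (y v : 'rV[R]_d) : 'rV[R]_d :=
  if `[< ediff g y >] then grad (fun z => h z + fine (g z)) y
  else grad h y + v.

(* Main.v *)
(* With u = y - x and r = |u|, the gradient of the model is
   G = grad f_p(y, x) + c u + g', where c = L (p + 1) r^(p-1) / p!, so that
     u + lambda (grad f(y) + g')
       = (1 - lambda c) u + lambda G + lambda (grad f(y) - grad f_p(y, x)).
   Taylor's formula for s |-> D f(x + s u)[h] bounds the last difference by
   L r^p / p!.  Identifying its Taylor polynomial with the gradient of f_p
   requires the symmetry of the higher derivatives.  With
   e = lambda L r^(p-1) / p!, the three terms add up to at most
   (1 - (p + 1) e + e / 2 + e) r <= (1 - p e / 2) r <= 3 r / 4. *)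
Require Import Defs.
From HB Require Import structures.
From mathcomp Require Import all_boot all_order all_algebra.
From mathcomp Require Import all_classical all_reals all_analysis.
From mathcomp Require Import lra ring.

Set Implicit Arguments.
Unset Strict Implicit.
Unset Printing Implicit Defensive.

Import Order.TTheory GRing.Theory Num.Theory.
Import numFieldNormedType.Exports.

Local Open Scope classical_set_scope.
Local Open Scope ring_scope.

(** * Mean value estimates and symmetry of second derivatives *)

Lemma is_derive_line (R : realType) (V : normedModType R) (F : V -> R)
    (x u : V) (t : R) :
  differentiable F (x + t *: u) ->
  is_derive t 1 (fun s : R => F (x + s *: u)) ('d F (x + t *: u) u).
Proof.
move=> dF.
have dl : is_diff t (fun s : R => x + s *: u) (fun s : R => s *: u).
  apply: (@is_diff_eq _ _ _ _ (0 + *:%R^~ u)).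
  by apply/funext => s; rewrite fctE add0r.
have dG : is_diff t (fun s : R => F (x + s *: u))
    ('d F (x + t *: u) \o (fun s : R => s *: u)).
  by apply: is_diff_comp; exact: differentiableP.
apply: DeriveDef; first by apply: diff_derivable.
by rewrite deriveE// diff_val/= scale1r.
Qed.

Lemma diff_remainder_near (R : realType) (V : normedModType R) (F : V -> R) (x : V) :
  differentiable F x ->
  forall e : R, 0 < e -> exists2 r : R, 0 < r &
    forall h : V, `|h| < r -> `|F (x + h) - F x - 'd F x h| <= e * `|h|.
Proof.
move=> /diff_locally/eqaddoP dF e e0.
have /nbhs_norm0P[r /= r0 Hr] := dF _ e0.
exists r => // h /Hr /=.
by rewrite !fctE /= opprD addrA (addrC h).
Qed.

Lemma is_derive_within_continuous (R : realType) (F dF : R -> R) (A : set R) :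
  (forall s : R, is_derive s 1 F (dF s)) -> {within A, continuous F}.
Proof.
move=> dFF; apply: continuous_subspaceT => s.
by apply/differentiable_continuous/derivable1_diffP; case: (dFF s).
Qed.

Lemma mean_value (R : realType) (F dF : R -> R) (a b : R) :
  a <= b -> (forall s : R, is_derive s 1 F (dF s)) ->
  exists2 c, a <= c <= b & F b - F a = dF c * (b - a).
Proof.
move=> ab dFF.
have [|c + E] := MVT_segment ab (fun s _ => dFF s).
  exact: is_derive_within_continuous dFF.
by rewrite in_itv /= => cab; exists c.
Qed.

(* Mean value theorem for s |-> F (x + t b + s a) - F (x + s a). *)
Lemma second_difference_near (R : realType) (V : normedModType R)
    (F : V -> R) (x a b : V) :
  (forall z, differentiable F z) -> differentiable (fun z => 'd F z a) x ->
  forall e : R, 0 < e -> exists2 r : R, 0 < r & forall t : R, 0 < t < r ->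
    `|F (x + t *: a + t *: b) - F (x + t *: a) - F (x + t *: b) + F x
      - t ^+ 2 * 'd (fun z => 'd F z a) x b| <= e * t ^+ 2.
Proof.
move=> dF dA e e0; set A := fun z => 'd F z a in dA *.
(* Two increments of [A] from [x] occur below, of norms at most t(|a| + |b|) and t|a|. Both lie
   below [r] and sum to at most tK. The summand 1 keeps [K] positive when a = b = 0. *)
pose K := 2 * (`|a| + `|b|) + 1.
have K0 : 0 < K by rewrite ltr_wpDl// mulr_ge0// addr_ge0.
have [r r0 Hr] := diff_remainder_near dA (divr_gt0 e0 K0).
exists (r / K); first exact: divr_gt0.
move=> t /andP[t0]; rewrite ltr_pdivlMr// => tK.
pose phi s := F (x + t *: b + s *: a) - F (x + s *: a).
have dphi (s : R) : is_derive s 1 phi (A (x + t *: b + s *: a) - A (x + s *: a)).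
  by apply: is_deriveB; apply: is_derive_line.
have [c /andP[c0 ct] Hc] := mean_value (ltW t0) dphi.
have -> : F (x + t *: a + t *: b) - F (x + t *: a) - F (x + t *: b) + F x
    = phi t - phi 0.
  by rewrite /phi !scale0r !addr0 (addrAC x); ring.
rewrite Hc subr0.
have nca : `|c *: a| <= t * `|a| by rewrite normrZ ger0_norm// ler_wpM2r.
have nab : `|t *: b + c *: a| <= t * (`|a| + `|b|).
  rewrite (le_trans (ler_normD _ _))// mulrDr addrC lerD//.
  by rewrite normrZ gtr0_norm.
have lt1 : t * (`|a| + `|b|) < r.
  rewrite (le_lt_trans _ tK)// ler_pM2l// /K.
  have := normr_ge0 a; have := normr_ge0 b; lra.
have lt2 : `|c *: a| < r.
  by rewrite (le_lt_trans nca)// (le_lt_trans _ lt1)// ler_pM2l// lerDl.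
have H1 := Hr _ (le_lt_trans nab lt1); have H2 := Hr _ lt2.
rewrite addrA linearD/= in H1.
(* Both values of [A] are expanded at [x], where [A] is known to be differentiable. The
   contributions of c a cancel, leaving t times the derivative along [b]. *)
have -> : (A (x + t *: b + c *: a) - A (x + c *: a)) * t - t ^+ 2 * 'd A x b =
   t * ((A (x + t *: b + c *: a) - A x - ('d A x (t *: b) + 'd A x (c *: a)))
     - (A (x + c *: a) - A x - 'd A x (c *: a))).
  have -> : 'd A x (t *: b) = t * 'd A x b by exact: linearZ.
  by ring.
rewrite normrM gtr0_norm// expr2 mulrCA ler_pM2l//.
rewrite (le_trans (ler_normB _ _))// (le_trans (lerD H1 H2))//.
rewrite -mulrDr -mulrA ler_pM2l// -ler_pdivlMl ?invr_gt0// invrK.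
apply: (le_trans (lerD nab nca)).
rewrite -mulrDr mulrC ler_pM2r// /K.
have := normr_ge0 a; have := normr_ge0 b; lra.
Qed.

(** The second difference [D] is symmetric in [a] and [b], and for small t it is within (e/2) t^2 of
    t^2 times either mixed derivative. Dividing by t^2, these differ by at most e, for every e >
    0. *)
Lemma diff_diff_symmetric (R : realType) (V : normedModType R)
    (F : V -> R) (x a b : V) :
  (forall z, differentiable F z) ->
  differentiable (fun z => 'd F z a) x -> differentiable (fun z => 'd F z b) x ->
  'd (fun z => 'd F z a) x b = 'd (fun z => 'd F z b) x a.
Proof.
move=> dF dA dB; apply/eqP; rewrite -subr_eq0 -normr_le0.
apply/ler_addgt0Pr => e e0; rewrite add0r.
have e20 : 0 < e / 2 by rewrite divr_gt0.
have [r r0 Hr] := second_difference_near b dF dA e20.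
have [s s0 Hs] := second_difference_near a dF dB e20.
pose t := Num.min r s / 2.
have t0 : 0 < t by rewrite divr_gt0// lt_min r0.
have m0 : 0 < Num.min r s by rewrite lt_min r0.
have tm : t < Num.min r s by rewrite /t; lra.
have tr : t < r by rewrite (lt_le_trans tm)// ge_min lexx.
have ts : t < s by rewrite (lt_le_trans tm)// ge_min lexx orbT.
have := Hr t; rewrite t0 tr => /(_ isT) {}Hr.
have := Hs t; rewrite t0 ts => /(_ isT).
rewrite (addrAC x (t *: b)).
have -> : F (x + t *: a + t *: b) - F (x + t *: b) - F (x + t *: a) + F x =
  F (x + t *: a + t *: b) - F (x + t *: a) - F (x + t *: b) + F x by ring.
move: Hr; set D := _ + F x; set p := 'd _ _ b; set q := 'd _ _ a => Hr Hs'.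
have t20 : 0 < t ^+ 2 by rewrite exprn_gt0.
rewrite -(ler_pM2l t20) -{1}(gtr0_norm t20) -normrM.
have -> : t ^+ 2 * (p - q) = (D - t ^+ 2 * q) - (D - t ^+ 2 * p) by ring.
rewrite (le_trans (ler_normB _ _))// (le_trans (lerD Hs' Hr))//.
lra.
Qed.

(** * A Taylor estimate in one variable *)

Lemma is_derive_pow_fact (R : realType) (k : nat) (s : R) :
  is_derive s 1 (fun s : R => s ^+ k.+1 / k.+1`!%:R) (s ^+ k / k`!%:R).
Proof.
have -> : (fun s : R => s ^+ k.+1 / k.+1`!%:R) =
  (k.+1`!%:R)^-1 *: ((id : R -> R) ^+ k.+1).
  by apply/funext => u; rewrite !fctE [RHS]mulrC.
have := is_deriveX k.+1 (@is_derive_id R R s 1).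
move=> /(@is_deriveZ _ _ _ _ (k.+1`!%:R)^-1 _ _ _) /is_derive_eq; apply.
rewrite /GRing.scale/= mulr1 factS natrM mulrC invfM.
have Sk0 : k.+1%:R != 0 :> R by [].
by rewrite [LHS]mulrA (mulrAC _ (s ^+ k)) divff// mul1r.
Qed.

(** [G k] is the k-th derivative of [G 0], and only its top member is controlled, by a Lipschitz
    bound from 0. Induction on n: the remainder of [G 0] has as derivative the remainder of [G 1],
    and the bound differentiates to the bound one order lower. So the bound minus and plus the
    remainder both vanish at 0 and have nonnegative derivatives for t >= 0, and the mean value
    theorem makes them nonnegative. *)
Lemma taylor_bound (R : realType) (n : nat) (G : nat -> R -> R) (M : R) :
  (forall k (t : R), (k < n)%N -> is_derive t 1 (G k) (G k.+1 t)) ->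
  (forall t, 0 <= t -> `|G n t - G n 0| <= M * t) ->
  forall t, 0 <= t ->
  `|G 0%N t - \sum_(k < n.+1) G k 0 * (t ^+ k / k`!%:R)|
    <= M * (t ^+ n.+1 / n.+1`!%:R).
Proof.
elim: n G => [|n IH] G dG GM t t0.
  rewrite big_ord_recl big_ord0 expr0 fact0 divr1 mulr1 addr0 expr1 divr1.
  exact: GM.
have {}IH := IH (fun k => G k.+1) (fun k t => dG k.+1 t) GM.
pose P s := \sum_(k < n.+2) G k 0 * (s ^+ k / k`!%:R).
pose P' s := \sum_(k < n.+1) G k.+1 0 * (s ^+ k / k`!%:R).
have dP (s : R) : is_derive s 1 P (P' s).
  have -> : P = cst (G 0%N 0) +
      \sum_(k < n.+1) (G k.+1 0 *: (fun s : R => s ^+ k.+1 / k.+1`!%:R)).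
    apply/funext => u; rewrite /P big_ord_recl expr0 fact0 divr1 mulr1.
    by rewrite !fctE fct_sumE; congr (_ + _); apply: eq_bigr.
  have -> : P' s = 0 + \sum_(k < n.+1) G k.+1 0 *: (s ^+ k / k`!%:R).
    by rewrite add0r.
  apply: is_deriveD; apply: is_derive_sum => k; apply: is_deriveZ.
  exact: is_derive_pow_fact.
have dH (s : R) : is_derive s 1 (G 0%N - P) (G 1%N s - P' s).
  by apply: is_deriveB; exact: dG.
have dm (s : R) : is_derive s 1 (M *: (fun s : R => s ^+ n.+2 / n.+2`!%:R))
    (M * (s ^+ n.+1 / n.+1`!%:R)).
  by apply: is_deriveZ; exact: is_derive_pow_fact.
have P0 : P 0 = G 0%N 0.
  rewrite /P big_ord_recl big1 ?addr0 ?expr0 ?fact0 ?divr1 ?mulr1// => i _.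
  by rewrite exprS !mul0r mulr0.
have [c /andP[c0 _] Ec] :=
  mean_value t0 (fun s => is_deriveB (dm s) (dH s)).
have [c' /andP[c0' _] Ec'] :=
  mean_value t0 (fun s => is_deriveD (dm s) (dH s)).
have := IH _ c0; rewrite -/(P' c) ler_norml => /andP[_ Hc].
have := IH _ c0'; rewrite -/(P' c') ler_norml => /andP[Hc' _].
have Hc0 : 0 <= (M * (c ^+ n.+1 / n.+1`!%:R) - (G 1%N c - P' c)) * (t - 0).
  by rewrite subr0 mulr_ge0// subr_ge0.
have Hc0' : 0 <= (M * (c' ^+ n.+1 / n.+1`!%:R) + (G 1%N c' - P' c')) * (t - 0).
  by rewrite subr0 mulr_ge0// -lerBlDl sub0r.
move: Hc0 Hc0'; rewrite -Ec -Ec' !fctE P0 expr0n/= mul0r -/(P t) ler_norml.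
rewrite /GRing.scale/= => ? ?; lra.
Qed.

(** * Euclidean inner product and norm *)

Lemma dotpC (R : realType) (d : nat) (u v : 'rV[R]_d) : dotp u v = dotp v u.
Proof. by apply: eq_bigr => i _; rewrite mulrC. Qed.

Lemma dotpDl (R : realType) (d : nat) (u v w : 'rV[R]_d) :
  dotp (u + v) w = dotp u w + dotp v w.
Proof. by rewrite -big_split; apply: eq_bigr => i _; rewrite mxE mulrDl. Qed.

Lemma dotpZl (R : realType) (d : nat) (c : R) (u w : 'rV[R]_d) :
  dotp (c *: u) w = c * dotp u w.
Proof. by rewrite mulr_sumr; apply: eq_bigr => i _; rewrite mxE mulrA. Qed.

Lemma dotp_ge0 (R : realType) (d : nat) (u : 'rV[R]_d) : 0 <= dotp u u.
Proof. by apply: sumr_ge0 => i _; rewrite -expr2 sqr_ge0. Qed.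

Lemma enorm_ge0 (R : realType) (d : nat) (u : 'rV[R]_d) : 0 <= enorm u.
Proof. exact: sqrtr_ge0. Qed.

Lemma enorm_sqr (R : realType) (d : nat) (u : 'rV[R]_d) :
  enorm u ^+ 2 = dotp u u.
Proof. by rewrite sqr_sqrtr// dotp_ge0. Qed.

Lemma enorm_eq0 (R : realType) (d : nat) (u : 'rV[R]_d) :
  enorm u = 0 -> u = 0.
Proof.
move=> u0; have /eqP : dotp u u = 0 by rewrite -enorm_sqr u0 expr0n.
rewrite psumr_eq0 => [/allP u00|i _]; last by rewrite -expr2 sqr_ge0.
apply/rowP => i; have := u00 i (mem_index_enum i).
by rewrite /= -expr2 sqrf_eq0 mxE => /eqP.
Qed.

Lemma enormZ (R : realType) (d : nat) (c : R) (u : 'rV[R]_d) :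
  enorm (c *: u) = `|c| * enorm u.
Proof.
rewrite /enorm dotpZl dotpC dotpZl mulrA -expr2 sqrtrM ?sqr_ge0//.
by rewrite sqrtr_sqr.
Qed.

Lemma cauchy_schwarz_dotp (R : realType) (d : nat) (u v : 'rV[R]_d) :
  dotp u v <= enorm u * enorm v.
Proof.
have [u0|u0] := eqVneq (enorm u) 0.
  by rewrite u0 mul0r (enorm_eq0 u0) -(scale0r 0) dotpZl mul0r.
have [v0|v0] := eqVneq (enorm v) 0.
  by rewrite v0 mulr0 (enorm_eq0 v0) dotpC -(scale0r 0) dotpZl mul0r.
have uv0 : 0 < enorm u * enorm v by rewrite mulr_gt0// lt0r enorm_ge0 ?u0 ?v0.
(* The squared norm of |v| u - |u| v equals 2 |u| |v| (|u| |v| - u.v), and its first factors are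
   positive here. *)
have := dotp_ge0 (enorm v *: u + (- enorm u) *: v).
rewrite dotpDl !dotpZl 2!(dotpC _ (_ + _)) !dotpDl !dotpZl -!enorm_sqr (dotpC v u).
have -> : enorm v * (enorm v * enorm u ^+ 2 + - enorm u * dotp u v) +
   - enorm u * (enorm v * dotp u v + - enorm u * enorm v ^+ 2) =
   2 * (enorm u * enorm v) * (enorm u * enorm v - dotp u v) by ring.
by rewrite pmulr_rge0 ?subr_ge0// mulr_gt0.
Qed.

Lemma enormD (R : realType) (d : nat) (u v : 'rV[R]_d) :
  enorm (u + v) <= enorm u + enorm v.
Proof.
rewrite -ler_sqr ?nnegrE ?addr_ge0 ?enorm_ge0// enorm_sqr.
rewrite dotpDl !(dotpC _ (_ + _)) !dotpDl -!enorm_sqr (dotpC v u).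
have := cauchy_schwarz_dotp u v; lra.
Qed.

(** Testing against h = v suffices. This reduces a bound on a gradient to bounds on directional
    derivatives. *)
Lemma enorm_le_dual (R : realType) (d : nat) (v : 'rV[R]_d) (C : R) :
  0 <= C -> (forall h, dotp v h <= C * enorm h) -> enorm v <= C.
Proof.
move=> C0 /(_ v); rewrite -enorm_sqr expr2.
have := enorm_ge0 v; rewrite le_eqVlt => /predU1P[<-//|v0].
by rewrite ler_pM2r.
Qed.

(** The inequality, in place of |v| = 1, admits u = 0 and matches the unit balls over which [opnorm]
    takes its supremum. *)
Lemma enorm_decomp (R : realType) (d : nat) (u : 'rV[R]_d) :
  exists2 v, enorm v <= 1 & u = enorm u *: v.
Proof.
have [u0|u0] := eqVneq (enorm u) 0.
  by exists 0; rewrite ?scaler0 ?(enorm_eq0 u0)// -(scale0r 0) enormZ normr0 mul0r.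
exists ((enorm u)^-1 *: u); last by rewrite scalerA divff// scale1r.
by rewrite enormZ ger0_norm ?invr_ge0 ?enorm_ge0// mulVf.
Qed.

(** * Gradients and differentials of elementary maps *)

Lemma dotp_grad (R : realType) (d : nat) (f : 'rV[R]_d -> R) (x h : 'rV[R]_d) :
  dotp (grad f x) h = 'd f x h.
Proof.
rewrite [in RHS](row_sum_delta h) raddf_sum /=.
by apply: eq_bigr => i _; rewrite mxE linearZ mulrC.
Qed.

Lemma is_diff_subr (R : realType) (V : normedModType R) (x y : V) :
  is_diff y (fun z => z - x) id.
Proof.
have -> : (fun z => z - x) = (id : V -> V) - cst x by [].
apply: (is_diff_eq (is_diffB (is_diff_id y) (is_diff_cst x y))).
by apply/funext => h; rewrite fctE subr0.
Qed.

Lemma is_diff_sum (R : realType) (V W : normedModType R) (n : nat)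
    (F dF : 'I_n -> V -> W) (x : V) :
  (forall i, is_diff x (F i) (dF i)) ->
  is_diff x (\sum_(i < n) F i) (\sum_(i < n) dF i).
Proof.
elim: n F dF => [|n IH] F dF dFF; first by rewrite !big_ord0; exact: is_diff_cst.
by rewrite !big_ord_recr; apply: is_diffD; exact: IH.
Qed.

Lemma is_diff_coord (R : realType) (d : nat) (u : 'rV[R]_d) (i : 'I_d) :
  is_diff u (fun z : 'rV[R]_d => z ord0 i : R) (fun h => h ord0 i).
Proof.
(* A continuous linear map is its own differential; the coordinate is packaged as a linear map so
   that this fact applies. *)
have @c : {linear 'rV[R]_d -> R}.
  by exists (fun N : 'rV[R]_d => N ord0 i); do 2![eexists]; do ?[constructor];
     rewrite ?mxE// => ? *; rewrite ?mxE//; move=> ?; rewrite !mxE.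
have cc : continuous c by exact: coord_continuous.
apply: DiffDef; first exact: differentiable_coord.
exact: (diff_lin u cc).
Qed.

(** * Symmetry and multilinearity of the higher derivatives *)

Lemma nseq_catS (T : Type) (k : nat) (a : T) (s : seq T) :
  nseq k.+1 a ++ s = nseq k a ++ a :: s.
Proof. by elim: k => //= k ->. Qed.

Section Symmetry.
Variables (R : realType) (d p : nat) (f : 'rV[R]_d -> R).
Hypothesis df : differentiable_upto p f.

(** The hypothesis is an equality of functions, not of values at one point, and so survives further
    differentiation. *)
Lemma Dn_catl (l hs hs' : seq 'rV[R]_d) :
  Dn f hs = Dn f hs' -> Dn f (l ++ hs) = Dn f (l ++ hs').
Proof. by move=> E; elim: l => //= h l ->. Qed.

Lemma Dn_swap (a b : 'rV[R]_d) (hs : seq 'rV[R]_d) :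
  ((size hs).+1 < p)%N -> Dn f [:: a, b & hs] = Dn f [:: b, a & hs].
Proof.
move=> sp; apply/funext => z /=; apply: diff_diff_symmetric => [w||].
- by apply: df; exact: ltnW.
- exact: (df (hs := b :: hs)).
- exact: (df (hs := a :: hs)).
Qed.

(** Adjacent swaps carry [b] to the head, the outermost differentiation, where linearity is that of
    a differential. Linearity in every other slot is obtained this way. *)
Lemma Dn_front (l hs : seq 'rV[R]_d) (b : 'rV[R]_d) :
  (size l + size hs < p)%N -> Dn f (l ++ b :: hs) = Dn f (b :: l ++ hs).
Proof.
elim: l => [//|a l IH] /= sp.
transitivity (Dn f [:: a, b & l ++ hs]).
  by apply: (@Dn_catl [:: a]); apply: IH; exact: ltnW.
by apply: Dn_swap; rewrite size_cat.
Qed.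

Lemma Dn_scale (c : R) (a : 'rV[R]_d) (l hs : seq 'rV[R]_d) (x : 'rV[R]_d) :
  (size l + size hs < p)%N ->
  Dn f (l ++ (c *: a) :: hs) x = c * Dn f (l ++ a :: hs) x.
Proof. by move=> sp; rewrite !Dn_front//=; exact: linearZ. Qed.

Lemma Dn_scale_nseq (c : R) (a : 'rV[R]_d) (k : nat) (hs : seq 'rV[R]_d)
    (x : 'rV[R]_d) :
  (k + size hs <= p)%N ->
  Dn f (nseq k (c *: a) ++ hs) x = c ^+ k * Dn f (nseq k a ++ hs) x.
Proof.
elim: k hs => [|k IH] hs sp; first by rewrite mul1r.
rewrite !nseq_catS IH ?addnS// Dn_scale ?size_nseq//.
by rewrite mulrA -exprSr.
Qed.

Lemma Dn_sum_delta (l hs : seq 'rV[R]_d) (h x : 'rV[R]_d) :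
  (size l + size hs < p)%N ->
  \sum_(i < d) h ord0 i * Dn f (l ++ delta_mx ord0 i :: hs) x
  = Dn f (l ++ h :: hs) x.
Proof.
move=> sp; rewrite Dn_front//= [in RHS](row_sum_delta h) raddf_sum /=.
by apply: eq_bigr => i _; rewrite Dn_front// linearZ.
Qed.

(** The last copy of z is expanded in the standard basis, which turns the map into a sum of
    coordinates times maps with one copy fewer. The product rule and induction on k apply, [hs]
    being general so that it can absorb the basis vector. *)
Lemma is_diff_Dn_nseq (x : 'rV[R]_d) (k : nat) (hs : seq 'rV[R]_d)
    (u : 'rV[R]_d) :
  (k + size hs <= p)%N ->
  is_diff u (fun z => Dn f (nseq k z ++ hs) x)
    (fun h => k%:R * Dn f (nseq k.-1 u ++ h :: hs) x).
Proof.
elim: k hs => [|k IH] hs sp.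
  apply: (@is_diff_eq _ _ _ _ 0); first exact: is_diff_cst.
  by apply/funext => h; rewrite mul0r.
pose c i := fun z : 'rV[R]_d => z ord0 i : R.
pose A i := fun z => Dn f (nseq k z ++ delta_mx ord0 i :: hs) x.
have -> : (fun z => Dn f (nseq k.+1 z ++ hs) x) = \sum_(i < d) c i * A i.
  apply/funext => z; rewrite fct_sumE nseq_catS -Dn_sum_delta ?size_nseq//.
apply: is_diff_eq.
  apply: is_diff_sum => i; apply: is_diffM; first exact: is_diff_coord.
  by apply: IH; rewrite /= addnS.
apply/funext => h; rewrite fct_sumE.
under eq_bigr => i _.
  rewrite !fctE /GRing.scale /= mulrCA [A i u * _]mulrC; over.
rewrite big_split/= -mulr_sumr Dn_sum_delta ?size_nseq//.
rewrite -natr1 mulrDl mul1r; congr (_ + _).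
(* For k = 0 the factor 0 removes the term in which [k.-1] takes its default value. *)
case: k IH sp A => [|k] _ sp _; first by rewrite !mul0r.
(* Summing over the basis restores [u] behind [h]; one swap then brings it next to the other
   copies. *)
congr (_ * _); under eq_bigr => i _ do rewrite -cat_rcons.
rewrite Dn_sum_delta ?size_rcons ?size_nseq// cat_rcons nseq_catS.
rewrite (Dn_catl (nseq k u) (Dn_swap h u _))//.
by move: sp; rewrite !addSn; apply: leq_trans; rewrite ltnS ltnS leq_addl.
Qed.
End Symmetry.

(** * The Taylor model and the error of its gradient *)

Lemma lipschitz_Dn (R : realType) (d p : nat) (L : R) (f : 'rV[R]_d -> R)
    (u h x y : 'rV[R]_d) :
  lipschitz_derivative p.+1 L f ->
  `|Dn f (nseq p u ++ [:: h]) x - Dn f (nseq p u ++ [:: h]) y|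
    <= L * enorm (x - y) * (enorm u ^+ p * enorm h).
Proof.
move=> [df Lf].
(* By homogeneity the norms of [u] and [h] factor out of every slot; the remaining directions lie in
   the unit ball and compete in the supremum [opnorm]. *)
have [v v1 uv] := enorm_decomp u; have [k k1 hk] := enorm_decomp h.
have E z : Dn f (nseq p u ++ [:: h]) z =
    enorm u ^+ p * enorm h * Dn f (nseq p v ++ [:: k]) z.
  rewrite {1}uv {1}hk (Dn_scale_nseq df) ?addn1// (Dn_scale df) ?mulrA//.
  by rewrite size_nseq addn0.
rewrite !E -mulrBr normrM ger0_norm ?mulr_ge0 ?exprn_ge0 ?enorm_ge0//.
rewrite mulrC ler_wpM2r ?mulr_ge0 ?exprn_ge0 ?enorm_ge0//.
have sz : size (nseq p v ++ [:: k]) == p.+1.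
  by rewrite size_cat size_nseq addn1.
rewrite -lee_fin; apply: le_trans (Lf x y).
apply: ereal_sup_ubound; exists (Tuple sz) => //= i.
have : tnth (Tuple sz) i \in nseq p v ++ [:: k] by exact: mem_tnth.
by rewrite mem_cat mem_nseq inE => /orP[/andP[_]|] /eqP ->.
Qed.

(** Differentiating the term of order k+1 yields a factor k+1, which turns 1/(k+1)! into 1/k!. The
    result is the Taylor polynomial of degree p-1 at [x] of z |-> D f(z)[h], evaluated at [y]. *)
Lemma is_diff_taylor (R : realType) (d p : nat) (f : 'rV[R]_d -> R)
    (x y : 'rV[R]_d) :
  differentiable_upto p f ->
  is_diff y (fun z => taylor p f z x)
    (fun h => \sum_(k < p) k`!%:R^-1 * Dn f (nseq k (y - x) ++ [:: h]) x).
Proof.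
move=> df.
pose T (k : 'I_p) (z : 'rV[R]_d) := Dn f (nseq k.+1 (z - x)) x.
have -> : (fun z => taylor p f z x) =
    cst (f x) + \sum_(k < p) (k.+1`!%:R^-1 : R) *: T k.
  apply/funext => z; rewrite /taylor big_add1 big_mkord.
  by rewrite fctE fct_sumE.
have dT k : is_diff y (T k)
    (fun h => k.+1%:R * Dn f (nseq k (y - x) ++ [:: h]) x).
  have := @is_diff_Dn_nseq _ _ _ _ df x k.+1 [::] (y - x).
  rewrite addn0 => /(_ (ltn_ord k)) dD.
  have := is_diff_comp (is_diff_subr x y) dD.
  by congr (is_diff _ _ _); apply/funext => z /=; rewrite cats0.
have := is_diffD (is_diff_cst (f x) y)
  (is_diff_sum (fun k : 'I_p => is_diffZ (k.+1`!%:R^-1) (dT k))).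
move=> /is_diff_eq; apply; apply/funext => h.
rewrite fctE fct_sumE add0r; apply: eq_bigr => k _.
have Sk0 : k.+1%:R != 0 :> R by [].
rewrite fctE /GRing.scale /= factS natrM mulrA [X in X * _ = _](_ : _ = k`!%:R^-1)//.
by rewrite mulrC invfM mulrA divff// mul1r.
Qed.

Lemma grad_taylor_error (R : realType) (d p : nat) (L : R)
    (f : 'rV[R]_d -> R) (x y : 'rV[R]_d) :
  (0 < p)%N -> 0 <= L -> lipschitz_derivative p L f ->
  enorm (grad f y - grad (fun z => taylor p f z x) y)
    <= L / p`!%:R * enorm (y - x) ^+ p.
Proof.
case: p => // p _ L0 Lf; have [df _] := Lf.
set u := y - x.
apply: enorm_le_dual => [|h].
  by rewrite !mulr_ge0 ?invr_ge0 ?exprn_ge0 ?enorm_ge0.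
rewrite dotpDl -scaleN1r dotpZl mulN1r !dotp_grad.
have -> : 'd (fun z => taylor p.+1 f z x) y h =
    \sum_(k < p.+1) k`!%:R^-1 * Dn f (nseq k u ++ [:: h]) x.
  by have dt := is_diff_taylor x y df; rewrite diff_val.
(* [G k] is the k-th derivative of t |-> D f(x + t u)[h]. The order of the model is now p+1, so the
   Lipschitz derivative D^(p+1) f appears in [G p]. *)
pose G k (t : R) := Dn f (nseq k u ++ [:: h]) (x + t *: u).
(* The first |u| is the speed of t |-> x + t u; the other factors are the norms of the p+1
   directions in [G p]. *)
pose M := L * enorm u * (enorm u ^+ p * enorm h).
have dG k (t : R) : (k < p)%N -> is_derive t 1 (G k) (G k.+1 t).
  move=> kp; apply: is_derive_line; apply: df.
  by rewrite size_cat size_nseq addn1.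
have GM (t : R) : 0 <= t -> `|G p t - G p 0| <= M * t.
  move=> t0; apply: (le_trans (lipschitz_Dn _ _ _ _ Lf)).
  rewrite scale0r addr0 addrAC subrr add0r enormZ ger0_norm// /M.
  by rewrite le_eqVlt; apply/orP; left; apply/eqP; ring.
have := taylor_bound dG GM ler01; rewrite !expr1n !mul1r.
have -> : G 0%N 1 = 'd f y h.
  by rewrite /G scale1r (_ : x + u = y)// /u addrC subrK.
under eq_bigr => k _ do rewrite expr1n mul1r mulrC /G scale0r addr0.
move=> /(le_trans (ler_norm _)) /le_trans; apply.
by rewrite /M le_eqVlt exprS; apply/orP; left; apply/eqP; ring.
Qed.

(** * Differentials of powers of the Euclidean norm *)

Lemma is_diff_dotpp (R : realType) (d : nat) (u : 'rV[R]_d) :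
  is_diff u (fun z : 'rV[R]_d => dotp z z) (fun h => 2 * dotp u h).
Proof.
pose c i := fun z : 'rV[R]_d => z ord0 i : R.
have -> : (fun z => dotp z z) = \sum_(i < d) c i * c i.
  by apply/funext => z; rewrite fct_sumE.
have dc i := is_diffM (is_diff_coord u i) (is_diff_coord u i).
apply: (is_diff_eq (is_diff_sum dc)).
apply/funext => h; rewrite fct_sumE mulr_sumr; apply: eq_bigr => i _.
by rewrite !fctE /GRing.scale /=; ring.
Qed.

(** For p = 1 the map is the quadratic form [dotp z z], smooth also at 0. For p >= 2 the chain rule
    goes through the square root, away from 0. The conditional hypothesis fits the main estimate,
    where y = x can occur when p = 1. *)
Lemma is_diff_enorm_pow (R : realType) (d p : nat) (u : 'rV[R]_d) :
  (0 < p)%N -> (1 < p)%N ==> (enorm u != 0) ->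
  is_diff u (fun z : 'rV[R]_d => enorm z ^+ p.+1)
    (fun h => p.+1%:R * enorm u ^+ p.-1 * dotp u h).
Proof.
case: p => [//|[|p]] _ /= u0.
  have -> : (fun z : 'rV[R]_d => enorm z ^+ 2) = (fun z => dotp z z).
    by apply/funext => z; rewrite enorm_sqr.
  apply: (is_diff_eq (is_diff_dotpp u)).
  by apply/funext => h; rewrite expr0 mulr1.
have du0 : 0 < dotp u u by rewrite -enorm_sqr exprn_gt0// lt0r u0 enorm_ge0.
have ds : is_diff (dotp u u) (Num.sqrt : R -> R)
    (fun h => h * (2 * Num.sqrt (dotp u u))^-1).
  have [sd sE] := is_derive1_sqrt du0.
  have sdiff := sd; move/derivable1_diffP in sdiff.
  apply: DiffDef => //.
  by rewrite (diff1E sdiff) derive1E sE.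
have dn : is_diff u (@enorm R d) (fun h => dotp u h / enorm u).
  have := is_diff_comp (is_diff_dotpp u) ds.
  move=> /is_diff_eq; apply; apply/funext => h /=; rewrite -/(enorm u).
  by field.
have -> : (fun z : 'rV[R]_d => enorm z ^+ p.+3) = @enorm R d ^+ p.+3.
  by apply/funext => z; rewrite exprfctE.
apply: (is_diff_eq (is_diffX p.+2 dn)); apply/funext => h.
by rewrite fctE /GRing.scale /= [enorm u ^+ p.+2]exprSr; field.
Qed.

Lemma dotp_deltar (R : realType) (d : nat) (u : 'rV[R]_d) (i : 'I_d) :
  dotp u (delta_mx ord0 i) = u ord0 i.
Proof.
rewrite /dotp (bigD1 i)//= big1 => [|j ji].
  by rewrite mxE !eqxx mulr1 addr0.
by rewrite mxE (negPf ji) andbF mulr0.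
Qed.

(** * The final estimate *)

Theorem lemma8 (R : realType) (d p : nat) (L : R)
    (f : 'rV[R]_d -> R) (g : 'rV[R]_d -> \bar R)
    (x y gy : 'rV[R]_d) (lambda : R) :
  (1 <= p)%N ->
  @convex_function R 'rV[R]_d [set: 'rV[R]_d] f ->
  lipschitz_derivative p L f ->
  proper_closed_convex g ->
  is_gprime g y gy ->
  enorm (composite_grad
           (fun z => taylor p f z x + L / p`!%:R * enorm (z - x) ^+ p.+1)
           g y gy)
    <= L / (2 * p`!%:R) * enorm (y - x) ^+ p ->
  0 < lambda ->
  1 / 2 <= lambda * (L * enorm (y - x) ^+ p.-1 / (p.-1)`!%:R) ->
  lambda * (L * enorm (y - x) ^+ p.-1 / (p.-1)`!%:R) <= p%:R / p.+1%:R ->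
  enorm (y - (x - lambda *: (grad f y + gy))) <= 3 / 4 * enorm (y - x).
Proof.
move=> p0 _ Lf _ [gy_diff _] Gle l0 eta_ge eta_le.
set r := enorm (y - x) in Gle eta_ge eta_le *.
have r0 : 0 <= r := enorm_ge0 _.
have eta0 : 0 < lambda * (L * r ^+ p.-1 / (p.-1)`!%:R) by lra.
(* The lower bound 1/2 forces L r^(p-1) > 0, which gives L > 0 and, for p >= 2, also r != 0. For p =
   1 the power is 1 even if r = 0. *)
have Lr0 : 0 < L * r ^+ p.-1.
  by move: eta0; rewrite pmulr_rgt0// pmulr_lgt0// invr_gt0 ltr0n fact_gt0.
have L0 : 0 < L.
  rewrite ltNge; apply/negP => L0; move: Lr0.
  by rewrite ltNge mulr_le0_ge0 ?exprn_ge0.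
have rn0 : (1 < p)%N ==> (r != 0).
  apply/implyP => p1; apply/eqP => re0; move: Lr0.
  by rewrite re0 expr0n -subn1 subn_eq0 leqNgt p1 mulr0 ltxx.
have [df _] := Lf.
pose c := L / p`!%:R * (p.+1%:R * r ^+ p.-1).
pose h z := taylor p f z x + L / p`!%:R * enorm (z - x) ^+ p.+1.
have dt := is_diff_taylor x y df.
have dN := is_diff_comp (is_diff_subr x y) (is_diff_enorm_pow p0 rn0).
have [diffh hE] := is_diffD dt (is_diffZ (L / p`!%:R) dN).
have gradh : grad h y = grad (fun z => taylor p f z x) y + c *: (y - x).
  case: dt => _ tE; apply/rowP => i.
  rewrite [LHS]mxE [RHS]mxE [X in _ = X + _]mxE [X in _ = _ + X]mxE.
  rewrite -(dotp_deltar (y - x)).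
  etransitivity; first exact: (congr1 (fun F => F (delta_mx ord0 i)) hE).
  by rewrite tE !fctE /GRing.scale /= -/r /c; ring.
(* Where [g] is differentiable, the gradient of the sum splits and [gy] is the gradient of [g]; the
   other branch is this sum by definition. *)
have GE : composite_grad h g y gy = grad h y + gy.
  rewrite /composite_grad; case: asboolP => // gd.
  rewrite (gy_diff gd); apply/rowP => i; rewrite !mxE.
  by rewrite (diffD diffh (gd.2)).
have rE : r ^+ p = r * r ^+ p.-1 by rewrite -exprS prednK.
have pE : p`!%:R = p%:R * (p.-1)`!%:R :> R.
  by rewrite -natrM -{1 2}(prednK p0) factS prednK.
have P1 : 1 <= p%:R :> R by rewrite ler1n.
have w0 : (p.-1)`!%:R != 0 :> R by rewrite pnatr_eq0 -lt0n fact_gt0.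
have P0 : p%:R != 0 :> R by rewrite pnatr_eq0 -lt0n.
pose e := lambda * (L / p`!%:R * r ^+ p.-1).
(* Since p! = p (p-1)!, the two step-size conditions read 1/2 <= p e <= p/(p+1). *)
have etaE : lambda * (L * r ^+ p.-1 / (p.-1)`!%:R) = p%:R * e.
  by rewrite /e pE; field; rewrite w0 P0.
rewrite etaE in eta_ge eta_le eta0.
have e0 : 0 < e by move: eta0; rewrite pmulr_rgt0// ltr0n.
have ePe : e <= p%:R * e by rewrite ler_peMl// ltW.
have cE : lambda * c = (p%:R + 1) * e.
  by rewrite /c /e -natr1; ring.
(* The upper condition amounts to (p+1) e <= 1, so the coefficient 1 - lambda c is nonnegative and
   equals its absolute value in the triangle inequality. *)
have c1 : lambda * c <= 1.
  rewrite cE; move: eta_le; rewrite -natr1 ler_pdivlMr ?addr_gt0 ?ltr0n// => H.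
  by rewrite -(ler_pM2l (lt_le_trans ltr01 P1)) mulr1 mulrCA mulrC.
have -> : y - (x - lambda *: (grad f y + gy)) = (1 - lambda * c) *: (y - x) +
   lambda *: (grad h y + gy) +
   lambda *: (grad f y - grad (fun z => taylor p f z x) y).
  by rewrite gradh; apply/rowP => i; rewrite !mxE; ring.
rewrite GE in Gle.
have Terr := grad_taylor_error x y p0 (ltW L0) Lf.
rewrite (le_trans (enormD _ _))// (le_trans (lerD (enormD _ _) (lexx _)))//.
rewrite !enormZ (gtr0_norm l0) ger0_norm ?subr_ge0// -/r.
rewrite -(ler_pM2l l0) in Gle; rewrite -(ler_pM2l l0) -/r in Terr.
apply: (le_trans (lerD (lerD (lexx _) Gle) Terr)).
have -> : lambda * (L / p`!%:R * r ^+ p) = e * r by rewrite rE /e; ring.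
have -> : lambda * (L / (2 * p`!%:R) * r ^+ p) = e / 2 * r.
  by rewrite rE /e invfM; ring.
(* The factor of r is 1 - p e + e/2; e <= p e and p e >= 1/2 bound it by 3/4. *)
rewrite cE -!mulrDl ler_wpM2r//; lra.
Qed.
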